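(* Let $\kappa,\beta>0$, let $V:\mathbb{R}^2\to\mathbb{R}$ be smooth, let $N\geq1$ be an integer and let $B_h$ be a real $N\times N$ matrix. Let $z_h(t)=(z_{h,j}(t))_{j=0}^{N-1}\in\mathbb{R}^{6N}$, $z_{h,j}(t)\in\mathbb{R}^6$, be a smooth solution of the semi-discrete system $$(I_N\otimes\mathbb{K})\frac{d}{dt}z_h+(B_h\otimes\mathbb{M})z_h=\nabla_z\mathfrak{S}(z_h).$$ Let $U(t),W(t)\in\mathbb{R}^{6N}$ be solutions of the variational equation $$(I_N\otimes\mathbb{K})\frac{d}{dt}Z+(B_h\otimes\mathbb{M})Z=\mathfrak{S}''(z_h)Z.$$ Then the discrete multi-symplectic conservation law $$\partial_t\langle(I_N\otimes\mathbb{K})U,W\rangle_{6N}+\langle(B_h\otimes\mathbb{M})U,W\rangle_{6N}+\langle(B_h^T\otimes\mathbb{M})U,W\rangle_{6N}=0$$ holds. In particular, if $B_h$ is skew-symmetric, then the total symplecticity is conserved in time: $$\partial_t\sum_{j=0}^{N-1}\omega_j=0,\qquad \omega_j(U,W)=\langle\mathbb{K}U_j,W_j\rangle_6,$$ where $U=(U_j)_{j=0}^{N-1}$, $W=(W_j)_{j=0}^{N-1}$ with $U_j,W_j\in\mathbb{R}^6$.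
   Context: This system is the spatial semi-discretization of the multi-symplectic form $\mathbb{K}z_t+\mathbb{M}z_x=\nabla_z\mathfrak{S}(z)$ of $\kappa u_{tt}+iu_t+\beta u_{xx}+f(u)=0$, with $z=(p,q,v,w,\phi,\varphi)^T\in\mathbb{R}^6$, in which $B_h$ approximates $\partial_x$. Here $$\mathbb{K}=\begin{pmatrix}0&1&0&0&-\kappa&0\\-1&0&0&0&0&-\kappa\\0&0&0&0&0&0\\0&0&0&0&0&0\\\kappa&0&0&0&0&0\\0&\kappa&0&0&0&0\end{pmatrix},\quad\mathbb{M}=\begin{pmatrix}0&0&-\beta&0&0&0\\0&0&0&-\beta&0&0\\\beta&0&0&0&0&0\\0&\beta&0&0&0&0\\0&0&0&0&0&0\\0&0&0&0&0&0\end{pmatrix},$$ $$\mathfrak{S}(z)=V(p,q)+\beta\,\frac{v^2+w^2}{2}+\kappa\,\frac{\phi^2+\varphi^2}{2}.$$ $I_N$ is the $N\times N$ identity, $\otimes$ is the Kronecker product, $\langle\cdot,\cdot\rangle_n$ is the Euclidean inner product on $\mathbb{R}^n$, $\nabla_z\mathfrak{S}(z_h)\in\mathbb{R}^{6N}$ is the vector with blocks $\nabla_z\mathfrak{S}(z_{h,j})\in\mathbb{R}^6$, and $\mathfrak{S}''(z_h)$ is the block diagonal matrix with $6\times6$ diagonal blocks given by the Hessians $\mathfrak{S}''(z_{h,j})$, $j=0,\dots,N-1$. *)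

(* Defs.v *)
From HB Require Import structures.
From mathcomp Require Import all_boot all_order all_algebra.
From mathcomp Require Import all_classical all_reals all_analysis.
From mathcomp Require Export mxtens.

Set Implicit Arguments.
Unset Strict Implicit.
Unset Printing Implicit Defensive.

Import Order.TTheory GRing.Theory Num.Theory.
Import numFieldNormedType.Exports.

Local Open Scope classical_set_scope.
Local Open Scope ring_scope.

(* For open D and a finite-dimensional domain E, [Ck D k f] says that all
   iterated directional derivatives of order k of f exist and are continuous
   on D; quantifying over all directions v is the same as quantifying over the
   coordinate directions. *)
Fixpoint Ck (R : realType) (E F : normedModType R) (D : set E) (k : nat)
    (f : E -> F) : Prop :=
  match k with
  | 0%N => forall x, D x -> {for x, continuous f}
  | k'.+1 => forall v, (forall x, D x -> derivable f x v) /\ Ck D k' ('D_v f)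
  end.

Definition smooth_on (R : realType) (E F : normedModType R) (D : set E)
    (f : E -> F) : Prop := forall k, Ck D k f.

Definition dot (R : realType) (n : nat) (u v : 'cV[R]_n) : R :=
  \sum_(i < n) u i 0 * v i 0.

Definition gradient (R : realType) (n : nat) (f : 'cV[R]_n -> R)
    (x : 'cV[R]_n) : 'cV[R]_n :=
  \col_i 'D_(delta_mx i 0) f x.

Definition hessian (R : realType) (n : nat) (f : 'cV[R]_n -> R)
    (x : 'cV[R]_n) : 'M[R]_n :=
  \matrix_(i, j) 'D_(delta_mx i 0) ('D_(delta_mx j 0) f) x.

(* R^(N m) = (R^m)^N is indexed by [mxtens_index (j, k)] (of value j m + k,
   j < N, k < m), as in the library's Kronecker product [A *t B]. *)
Definition block (R : realType) (N m : nat) (z : 'cV[R]_(N * m)) (j : 'I_N) :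
    'cV[R]_m :=
  \col_k z (mxtens_index (j, k)) 0.

Definition of_blocks (R : realType) (N m : nat) (b : 'I_N -> 'cV[R]_m) :
    'cV[R]_(N * m) :=
  \col_i b (mxtens_unindex i).1 (mxtens_unindex i).2 0.

Definition block_diag (R : realType) (N m : nat) (A : 'I_N -> 'M[R]_m) :
    'M[R]_(N * m) :=
  \matrix_(a, b)
    if (mxtens_unindex a).1 == (mxtens_unindex b).1
    then A (mxtens_unindex a).1 (mxtens_unindex a).2 (mxtens_unindex b).2
    else 0.

Definition mx_of_rows (R : realType) (n : nat) (s : seq (seq R)) : 'M[R]_n :=
  \matrix_(i, j) nth 0 (nth [::] s i) j.

Definition Kmx (R : realType) (kappa : R) : 'M[R]_6 := mx_of_rows 6
  [:: [:: 0;     1;     0; 0; - kappa; 0];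
      [:: -1;    0;     0; 0; 0;       - kappa];
      [:: 0;     0;     0; 0; 0;       0];
      [:: 0;     0;     0; 0; 0;       0];
      [:: kappa; 0;     0; 0; 0;       0];
      [:: 0;     kappa; 0; 0; 0;       0]].

Definition Mmx (R : realType) (beta : R) : 'M[R]_6 := mx_of_rows 6
  [:: [:: 0;    0;    - beta; 0;      0; 0];
      [:: 0;    0;    0;      - beta; 0; 0];
      [:: beta; 0;    0;      0;      0; 0];
      [:: 0;    beta; 0;      0;      0; 0];
      [:: 0;    0;    0;      0;      0; 0];
      [:: 0;    0;    0;      0;      0; 0]].

(* Coordinates 0, ..., 5 of z are p, q, v, w, phi, varphi. *)
Definition Sfun (R : realType) (kappa beta : R) (V : 'cV[R]_2 -> R)
    (z : 'cV[R]_6) : R :=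
  let c (k : nat) := z (inord k) 0 in
  V (\col_(i < 2) c i)
  + beta * ((c 2 ^+ 2 + c 3 ^+ 2) / 2)
  + kappa * ((c 4 ^+ 2 + c 5 ^+ 2) / 2).

Definition gradS (R : realType) (kappa beta : R) (V : 'cV[R]_2 -> R)
    (N : nat) (z : 'cV[R]_(N * 6)) : 'cV[R]_(N * 6) :=
  of_blocks (fun j => gradient (Sfun kappa beta V) (block z j)).

Definition hessS (R : realType) (kappa beta : R) (V : 'cV[R]_2 -> R)
    (N : nat) (z : 'cV[R]_(N * 6)) : 'M[R]_(N * 6) :=
  block_diag (fun j => hessian (Sfun kappa beta V) (block z j)).

Definition semidiscrete_solution (R : realType) (kappa beta : R)
    (V : 'cV[R]_2 -> R) (N : nat) (B : 'M[R]_N) (I : set R)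
    (z : R -> 'cV[R]_(N * 6)) : Prop :=
  smooth_on I z /\
  forall t, I t ->
    (1%:M *t Kmx kappa) *m derive1 z t + (B *t Mmx beta) *m z t
    = gradS kappa beta V (z t).

Definition variational_solution (R : realType) (kappa beta : R)
    (V : 'cV[R]_2 -> R) (N : nat) (B : 'M[R]_N) (I : set R)
    (z Z : R -> 'cV[R]_(N * 6)) : Prop :=
  forall t, I t ->
    derivable Z t 1 /\
    (1%:M *t Kmx kappa) *m derive1 Z t + (B *t Mmx beta) *m Z t
    = hessS kappa beta V (z t) *m Z t.

Definition omega (R : realType) (kappa : R) (N : nat)
    (U W : 'cV[R]_(N * 6)) (j : 'I_N) : R :=
  dot (Kmx kappa *m block U j) (block W j).

(* Main.v *)
Require Import Defs.
From mathcomp Require Import all_boot all_order all_algebra.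
From mathcomp Require Import all_classical all_reals all_analysis.
From mathcomp Require Import ring lra.
Import Order.TTheory GRing.Theory Num.Theory.
Import numFieldNormedType.Exports.
Local Open Scope classical_set_scope.
Local Open Scope ring_scope.

(** The law is pure linear algebra once the Hessian is known to be symmetric.
    With K = 1 *t Kmx, M = B *t Mmx and H the block diagonal Hessian, the
    product rule gives
      d/dt <K U, W> = <K U', W> + <K U, W'> = <K U', W> - <U, K W'>
    because Kmx is skew-symmetric.  The variational equation turns this into
    <H U, W> - <U, H W> - <M U, W> + <U, M W>.  The H terms cancel by symmetry,
    and <U, M W> = <M^T U, W> = - <(B^T *t Mmx) U, W> because Mmx is
    skew-symmetric; this is [multisymplectic_identity].  If B is
    skew-symmetric, the two M terms are opposite, and <K U, W> is the total
    symplecticity since K acts block by block ([sum_omega]).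

    The symmetry of the Hessian ([hessian_Sfun_sym]) is where the smoothness
    of V enters, through the symmetry of second derivatives ([schwarz]).
    Smoothness is expressed by directional derivatives only, so [schwarz] is
    proved for them directly: by two applications of the mean value theorem,
    the second difference of f over a parallelogram with sides s u and s v is
    s^2 times a mixed derivative at some inner point, in either order of
    differentiation, and one lets s tend to 0. *)

(** * Directional derivatives *)

(** The difference quotients of both sides are the same function of the
    increment, which settles existence and value of the limit at once. *)
Lemma is_derive_line (R : realType) (E : normedModType R) (f : E -> R)
    (x v : E) (t df : R) : is_derive (x + t *: v) v f df ->
  is_derive t 1 (fun s : R => f (x + s *: v)) df.
Proof.
have quotE : (fun h : R => h^-1 *: (f (x + (h *: 1 + t) *: v)
      - f (x + t *: v))) =
    (fun h : R => h^-1 *: (f (h *: v + (x + t *: v)) - f (x + t *: v))).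
  apply/funext => h; congr (_ *: (f _ - _)).
  by rewrite [h *: 1]mulr1 scalerDl addrCA.
move=> [dbl <-]; apply: DeriveDef.
- by rewrite /derivable /= quotE.
- by rewrite /derive /= quotE.
Qed.

(** As for lines, the difference quotients of both sides coincide. *)
Lemma is_derive_comp_linear (R : realType) (E F : normedModType R)
    (L : E -> F) (f : F -> R) (x v : E) (df : R) : linear L ->
  is_derive (L x) (L v) f df -> is_derive x v (fun y => f (L y)) df.
Proof.
move=> linL.
have quotE : (fun h : R => h^-1 *: (f (L (h *: v + x)) - f (L x))) =
    (fun h : R => h^-1 *: (f (h *: L v + L x) - f (L x))).
  by apply/funext => h; rewrite linL.
move=> [dbl <-]; apply: DeriveDef.
- by rewrite /derivable /= quotE.
- by rewrite /derive /= quotE.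
Qed.

Lemma is_derive_coord (R : realType) (E : normedModType R) (m n : nat)
    (M : E -> 'M[R]_(m, n)) (x v : E) (dM : 'M[R]_(m, n)) (i : 'I_m)
    (j : 'I_n) :
  is_derive x v M dM -> is_derive x v (fun y => M y i j) (dM i j).
Proof.
move=> [dbl <-]; apply: DeriveDef; first by move/derivable_mxP: dbl; exact.
by rewrite derive_mx // mxE.
Qed.

Lemma is_derive_linear (R : realType) (E : normedModType R) (L : E -> R)
    (x v : E) : linear L -> is_derive x v L (L v).
Proof. by move=> linL; apply: (is_derive_comp_linear R E R L id). Qed.

Lemma is_derive_row (R : realType) (E : normedModType R) (m n : nat)
    (A : 'M[R]_(m, n)) (u : E -> 'cV[R]_n) (x v : E) (du : 'cV[R]_n)
    (i : 'I_m) :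
  is_derive x v u du ->
  is_derive x v (fun y => (A *m u y) i 0) ((A *m du) i 0).
Proof.
move=> dud; rewrite mxE.
have -> : (fun y => (A *m u y) i 0) = \sum_j (A i j \*: (fun y => u y j 0)).
  by apply/funext => y; rewrite fct_sumE mxE.
apply: is_derive_sum => j; apply: is_deriveZ; exact: is_derive_coord.
Qed.

Lemma is_derive_dot (R : realType) (E : normedModType R) (n : nat)
    (u w : E -> 'cV[R]_n) (x v : E) (du dw : 'cV[R]_n) :
    (forall i, is_derive x v (fun y => u y i 0) (du i 0)) ->
    (forall i, is_derive x v (fun y => w y i 0) (dw i 0)) ->
  is_derive x v (fun y => dot (u y) (w y)) (dot du (w x) + dot (u x) dw).
Proof.
move=> dud dwd; rewrite /dot -big_split /=.
have -> : (fun y => \sum_(i < n) u y i 0 * w y i 0) =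
    \sum_(i < n) ((fun y => u y i 0) * (fun y => w y i 0)).
  by apply/funext => y; rewrite fct_sumE.
apply: is_derive_sum => i.
apply: (is_derive_eq (is_deriveM (dud i) (dwd i))).
by rewrite addrC [_ *: dw i 0]/(_ * _) [w x i 0 *: _]/(_ * _) (mulrC (du i 0)).
Qed.

(** * Symmetry of second derivatives *)

(** The second difference is the increment over [0, s] of
    r |-> f (x + s v + r u) - f (x + r u); its derivative at the mean value a
    is an increment of fu in the direction v, to which the mean value theorem
    applies again. *)
Lemma second_difference_MVT (R : realType) (E : normedModType R)
    (f fu fuv : E -> R) (x u v : E) (s : R) : 0 < s ->
    (forall y, is_derive y u f (fu y)) -> (forall y, is_derive y v fu (fuv y)) ->
  exists2 ab : R * R, (0 < ab.1 < s) && (0 < ab.2 < s) &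
    f (x + s *: u + s *: v) - f (x + s *: u) - f (x + s *: v) + f x
    = s ^+ 2 * fuv (x + ab.1 *: u + ab.2 *: v).
Proof.
move=> s0 dfu dfuv.
have dg (t : R) : is_derive t 1
    (fun r : R => f (x + s *: v + r *: u) - f (x + r *: u))
    (fu (x + s *: v + t *: u) - fu (x + t *: u)).
  by apply: is_deriveB; apply: is_derive_line.
have [|a a_in Da] := MVT s0 (fun t _ => dg t).
  apply: derivable_within_continuous => t _.
  by case: (dg t).
have dh (t : R) : is_derive t 1 (fun r : R => fu (x + a *: u + r *: v))
    (fuv (x + a *: u + t *: v)) by exact: is_derive_line.
have [|b b_in Db] := MVT s0 (fun t _ => dh t).
  apply: derivable_within_continuous => t _.
  by case: (dh t).
exists (a, b); first by move: a_in b_in; rewrite !in_itv /= => -> ->.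
move: Da Db; rewrite !scale0r !addr0 !subr0 => Da Db.
rewrite /= (addrAC x (s *: u)).
transitivity (f (x + s *: v + s *: u) - f (x + s *: u)
  - (f (x + s *: v) - f x)).
  by rewrite opprD opprK !addrA.
by rewrite Da (addrAC x (s *: v)) Db expr2 -mulrA mulrC.
Qed.

(** The form in which continuity meets the mean value points, about which
    only 0 < a, b < s is known. *)
Lemma small_parallelogram (R : realType) (E : normedModType R) (g : E -> R)
    (x u v : E) (e : R) : 0 < e -> {for x, continuous g} ->
  exists2 d : R, 0 < d & forall a b : R,
    0 < a < d -> 0 < b < d -> `|g x - g (x + a *: u + b *: v)| < e.
Proof.
move=> e0 /cvgrPdist_lt /(_ e e0) /nbhs_ballP[r /= r0 gr].
(* The summand 1 keeps c positive when u = v = 0. *)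
set c := 1 + `|u| + `|v|.
have c0 : 0 < c by rewrite /c -addrA ltr_pwDl // addr_ge0.
exists (r / c); first by rewrite divr_gt0.
move=> a b /andP[a0 ad] /andP[b0 bd]; apply: gr.
rewrite -ball_normE /= -addrA opprD addNKr normrN.
apply: le_lt_trans (ler_normD _ _) _.
rewrite !normrZ !gtr0_norm //.
have au : a * `|u| <= r / c * `|u| by rewrite ler_wpM2r // ltW.
have bv : b * `|v| <= r / c * `|v| by rewrite ler_wpM2r // ltW.
have d0 : 0 < r / c by rewrite divr_gt0.
have : r / c * c = r by rewrite divfK // gt_eqF.
move: (r / c) au bv d0 => d au bv d0; rewrite /c => <-.
by rewrite !mulrDr mulr1 -addrA ltr_pwDl // lerD.
Qed.

(** Swapping u and v leaves the second difference unchanged, so fuv and fvu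
    take the same value at two points of arbitrarily small parallelograms. *)
Lemma schwarz (R : realType) (E : normedModType R) (f fu fv fuv fvu : E -> R)
    (x u v : E) :
    (forall y, is_derive y u f (fu y)) -> (forall y, is_derive y v f (fv y)) ->
    (forall y, is_derive y v fu (fuv y)) ->
    (forall y, is_derive y u fv (fvu y)) ->
    {for x, continuous fuv} -> {for x, continuous fvu} ->
  fuv x = fvu x.
Proof.
move=> dfu dfv dfuv dfvu cuv cvu.
apply/eqP; rewrite -subr_eq0 -normr_le0; apply/ler_addgt0Pr => e e0.
rewrite add0r.
have e20 : 0 < e / 2 by rewrite divr_gt0.
have [d1 d10 near1] := small_parallelogram R E fuv x u v _ e20 cuv.
have [d2 d20 near2] := small_parallelogram R E fvu x v u _ e20 cvu.
pose s := Num.min d1 d2.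
have s0 : 0 < s by rewrite lt_min d10.
have sd1 : s <= d1 by rewrite ge_min lexx.
have sd2 : s <= d2 by rewrite ge_min lexx orbT.
have [[a b] /= /andP[/andP[a0 sa] /andP[b0 sb]] Euv] :=
  second_difference_MVT R E f fu fuv x u v s s0 dfu dfuv.
have [[a' b'] /= /andP[/andP[a'0 sa'] /andP[b'0 sb']] Evu] :=
  second_difference_MVT R E f fv fvu x v u s s0 dfv dfvu.
have mixedE : fuv (x + a *: u + b *: v) = fvu (x + a' *: v + b' *: u).
  have s2 : s ^+ 2 != 0 by rewrite expf_neq0 // gt_eqF.
  apply: (mulfI s2); rewrite -Euv -Evu.
  by rewrite (addrAC x (s *: u)) (addrAC (f _)).
have duv : `|fuv x - fuv (x + a *: u + b *: v)| < e / 2.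
  by apply: near1; rewrite ?a0 ?b0 /= (lt_le_trans _ sd1).
have dvu : `|fvu x - fuv (x + a *: u + b *: v)| < e / 2.
  by rewrite mixedE; apply: near2; rewrite ?a'0 ?b'0 /= (lt_le_trans _ sd2).
move: (fuv (_ + _)) duv dvu => c; rewrite !ltr_norml ler_norml.
by move=> /andP[? ?] /andP[? ?]; apply/andP; split; lra.
Qed.

(** * Inner products, Kronecker products and blocks *)

Lemma dotE (R : realType) (n : nat) (u v : 'cV[R]_n) :
  dot u v = (u^T *m v) 0 0.
Proof. by rewrite mxE; apply: eq_bigr => i _; rewrite mxE. Qed.

Lemma dot_adjoint (R : realType) (m n : nat) (A : 'M[R]_(m, n))
    (u : 'cV[R]_n) (v : 'cV[R]_m) : dot (A *m u) v = dot u (A^T *m v).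
Proof. by rewrite !dotE trmx_mul mulmxA. Qed.

Lemma dotDl (R : realType) (n : nat) (u v w : 'cV[R]_n) :
  dot (u + v) w = dot u w + dot v w.
Proof. by rewrite !dotE linearD mulmxDl mxE. Qed.

Lemma dotDr (R : realType) (n : nat) (u v w : 'cV[R]_n) :
  dot w (u + v) = dot w u + dot w v.
Proof. by rewrite !dotE mulmxDr mxE. Qed.

Lemma dotNl (R : realType) (n : nat) (u v : 'cV[R]_n) :
  dot (- u) v = - dot u v.
Proof. by rewrite !dotE linearN mulNmx mxE. Qed.

Lemma dotNr (R : realType) (n : nat) (u v : 'cV[R]_n) :
  dot u (- v) = - dot u v.
Proof. by rewrite !dotE mulmxN mxE. Qed.

Lemma tensmxNl (R : realType) (m n p q : nat) (A : 'M[R]_(m, n))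
    (B : 'M[R]_(p, q)) : (- A) *t B = - (A *t B).
Proof. by apply/matrixP => i j; rewrite !mxE mulNr. Qed.

Lemma tensmxNr (R : realType) (m n p q : nat) (A : 'M[R]_(m, n))
    (B : 'M[R]_(p, q)) : A *t (- B) = - (A *t B).
Proof. by apply/matrixP => i j; rewrite !mxE mulrN. Qed.

Lemma sum_mxtens (R : realType) (N m : nat) (F : 'I_(N * m) -> R) :
  \sum_i F i = \sum_(j < N) \sum_(k < m) F (mxtens_index (j, k)).
Proof.
rewrite pair_big (reindex (@mxtens_index N m)) /=; last first.
  by exists (@mxtens_unindex N m) => i _; rewrite (mxtens_indexK, mxtens_unindexK).
by apply: eq_bigr => -[].
Qed.

Lemma dot_blocks (R : realType) (N m : nat) (u v : 'cV[R]_(N * m)) :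
  dot u v = \sum_(j < N) dot (block u j) (block v j).
Proof.
rewrite /dot sum_mxtens; apply: eq_bigr => j _; apply: eq_bigr => k _.
by rewrite !mxE.
Qed.

Lemma block_tens1mx (R : realType) (N m : nat) (A : 'M[R]_m)
    (u : 'cV[R]_(N * m)) (j : 'I_N) :
  block ((1%:M *t A) *m u) j = A *m block u j.
Proof.
apply/colP => k; rewrite !mxE sum_mxtens (bigD1 j) //= [X in _ + X]big1.
  rewrite addr0; apply: eq_bigr => l _.
  by rewrite tensmxE !mxE eqxx mul1r.
move=> i ij; apply: big1 => l _.
by rewrite tensmxE mxE eq_sym (negbTE ij) !mul0r.
Qed.

Lemma trmx_block_diag (R : realType) (N m : nat) (A : 'I_N -> 'M[R]_m) :
  (block_diag A)^T = block_diag (fun j => (A j)^T).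
Proof.
apply/matrixP => a b; rewrite !mxE eq_sym.
by case: eqP => // ->.
Qed.

(** * The structure matrices and the Hessian *)

Lemma trmx_Kmx (R : realType) (kappa : R) : (Kmx kappa)^T = - Kmx kappa.
Proof.
apply/matrixP => -[i +] -[j +].
by do 6?[case: i => [|i]] => // ?; do 6?[case: j => [|j]] => // ?;
  rewrite !mxE /= ?oppr0 ?opprK.
Qed.

Lemma trmx_Mmx (R : realType) (beta : R) : (Mmx beta)^T = - Mmx beta.
Proof.
apply/matrixP => -[i +] -[j +].
by do 6?[case: i => [|i]] => // ?; do 6?[case: j => [|j]] => // ?;
  rewrite !mxE /= ?oppr0 ?opprK.
Qed.

(** Sfun is V composed with the linear map L onto the first two coordinates,
    plus half the quadratic form of the symmetric bilinear form b.  Hence its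
    second derivative along v, then u, is that of V along L v, L u plus
    b u v, and both summands are symmetric. *)
Lemma hessian_Sfun_sym (R : realType) (kappa beta : R) (V : 'cV[R]_2 -> R)
    (z : 'cV[R]_6) : smooth_on setT V ->
  (hessian (Sfun kappa beta V) z)^T = hessian (Sfun kappa beta V) z.
Proof.
move=> smV.
pose L (y : 'cV[R]_6) : 'cV[R]_2 := \col_(i < 2) y (inord i) 0.
have linL : linear L by move=> a x y; apply/colP => i; rewrite !mxE.
pose c k (y : 'cV[R]_6) : R := y (inord k) 0.
have linc k : linear (c k) by move=> a x y; rewrite /c !mxE.
pose b (x y : 'cV[R]_6) : R :=
  beta * (c 2 x * c 2 y + c 3 x * c 3 y)
  + kappa * (c 4 x * c 4 y + c 5 x * c 5 y).
have bC x y : b x y = b y x by rewrite /b; ring.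
have linb y : linear (b^~ y).
  by move=> a x x'; rewrite /b !linc /GRing.scale /=; ring.
have dS x v : is_derive x v (Sfun kappa beta V) ('D_(L v) V (L x) + b x v).
  have -> : Sfun kappa beta V = (fun y => V (L y)) +
      2^-1 \*: (beta \*: (c 2 * c 2 + c 3 * c 3)
                + kappa \*: (c 4 * c 4 + c 5 * c 5)).
    apply/funext => y; rewrite /Sfun -addrA; congr (_ + _).
    change (beta * ((c 2 y ^+ 2 + c 3 y ^+ 2) / 2)
      + kappa * ((c 4 y ^+ 2 + c 5 y ^+ 2) / 2) =
      2^-1 * (beta * (c 2 y * c 2 y + c 3 y * c 3 y)
        + kappa * (c 4 y * c 4 y + c 5 y * c 5 y))).
    by field.
  have dc k : is_derive x v (c k) (c k v) by exact: is_derive_linear.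
  apply: is_deriveD.
    apply: is_derive_comp_linear => //; apply: derivableP.
    by have [+ _] := smV 1 (L v); exact.
  have dsq k : is_derive x v (c k * c k) (2 * (c k x * c k v)).
    apply: (is_derive_eq (is_deriveM (dc k) (dc k))).
    by rewrite mulr_natl.
  apply: (is_derive_eq (is_deriveZ _ (is_deriveD
    (is_deriveZ _ (is_deriveD (dsq 2) (dsq 3)))
    (is_deriveZ _ (is_deriveD (dsq 4) (dsq 5)))))).
  rewrite /b /GRing.scale /=.
  move: (c 2 x * _) (c 3 x * _) (c 4 x * _) (c 5 x * _) => q2 q3 q4 q5.
  by field.
have DV : forall v, 'D_v (Sfun kappa beta V) = fun x => 'D_(L v) V (L x) + b x v.
  by move=> w; apply/funext => x; have [] := dS x w.
have D2V u v : 'D_u ('D_v (Sfun kappa beta V)) z =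
    'D_(L u) ('D_(L v) V) (L z) + b u v.
  rewrite DV.
  suff [] : is_derive z u (fun x => 'D_(L v) V (L x) + b x v)
      ('D_(L u) ('D_(L v) V) (L z) + b u v) by [].
  apply: is_deriveD; last exact: is_derive_linear (linb v).
  apply: (is_derive_comp_linear R _ _ L ('D_(L v) V)) => //.
  apply: derivableP.
  by have [_ /(_ (L u))[+ _]] := smV 2 (L v); exact.
have dV w y : is_derive y w V ('D_w V y).
  by apply: derivableP; have [+ _] := smV 1 w; exact.
have d2V w w' y : is_derive y w' ('D_w V) ('D_w' ('D_w V) y).
  by apply: derivableP; have [_ /(_ w')[+ _]] := smV 2 w; exact.
have c2V w w' y : {for y, continuous ('D_w' ('D_w V))}.
  by have [_ /(_ w')[_ +]] := smV 2 w; exact.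
have V_sym w w' y : 'D_w ('D_w' V) y = 'D_w' ('D_w V) y.
  exact: (schwarz R _ V _ _ _ _ y w' w (dV w') (dV w) (d2V w' w) (d2V w w')
    (c2V w' w y) (c2V w w' y)).
have S_sym u v : 'D_u ('D_v (Sfun kappa beta V)) z =
    'D_v ('D_u (Sfun kappa beta V)) z by rewrite (D2V u v) (D2V v u) V_sym bC.
by apply/matrixP => i j; rewrite mxE [LHS]mxE [RHS]mxE S_sym.
Qed.

Lemma trmx_hessS (R : realType) (kappa beta : R) (V : 'cV[R]_2 -> R)
    (N : nat) (z : 'cV[R]_(N * 6)) : smooth_on setT V ->
  (hessS kappa beta V z)^T = hessS kappa beta V z.
Proof.
move=> smV; rewrite /hessS trmx_block_diag; congr block_diag.
by apply/funext => j; exact: hessian_Sfun_sym.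
Qed.

Lemma sum_omega (R : realType) (kappa : R) (N : nat) (U W : 'cV[R]_(N * 6)) :
  \sum_(j < N) omega kappa U W j = dot ((1%:M *t Kmx kappa) *m U) W.
Proof.
by rewrite dot_blocks; apply: eq_bigr => j _; rewrite block_tens1mx.
Qed.

(** * The conservation law *)

(** The product rule and the variational equation at one instant: du and dw
    are the time derivatives, and M' is B^T *t Mmx, which is - M^T because
    only the second Kronecker factor of M is skew-symmetric. *)
Lemma multisymplectic_identity (R : realType) (n : nat) (K M M' H : 'M[R]_n)
    (u w du dw : 'cV[R]_n) :
    K^T = - K -> M^T = - M' -> H^T = H ->
    K *m du + M *m u = H *m u -> K *m dw + M *m w = H *m w ->
  dot (K *m du) w + dot (K *m u) dw + dot (M *m u) w + dot (M' *m u) w = 0.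
Proof.
move=> KT MT HT eqU eqW.
have Kdu : K *m du = H *m u - M *m u by rewrite -eqU addrK.
have Kdw : K *m dw = H *m w - M *m w by rewrite -eqW addrK.
have dotH : dot u (H *m w) = dot (H *m u) w by rewrite dot_adjoint HT.
have dotM : dot u (M *m w) = - dot (M' *m u) w.
  by rewrite -[M]trmxK -dot_adjoint MT mulNmx dotNl.
rewrite [dot (K *m u) dw]dot_adjoint KT mulNmx Kdu Kdw.
rewrite dotNr dotDl dotDr dotNl dotNr dotH dotM.
by ring.
Qed.

Theorem mainTheorem8 (R : realType) (kappa beta : R)
    (hkappa : 0 < kappa) (hbeta : 0 < beta)
    (V : 'cV[R]_2 -> R) (hV : smooth_on setT V)
    (N : nat) (hN : (1 <= N)%N) (B : 'M[R]_N)
    (I : set R) (openI : open I) (intervalI : is_interval I)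
    (z : R -> 'cV[R]_(N * 6))
    (hz : semidiscrete_solution kappa beta V B I z)
    (U W : R -> 'cV[R]_(N * 6))
    (hU : variational_solution kappa beta V B I z U)
    (hW : variational_solution kappa beta V B I z W) :
  (forall t, I t ->
     derivable (fun s => dot ((1%:M *t Kmx kappa) *m U s) (W s)) t 1 /\
     derive1 (fun s => dot ((1%:M *t Kmx kappa) *m U s) (W s)) t
     + dot ((B *t Mmx beta) *m U t) (W t)
     + dot ((B^T *t Mmx beta) *m U t) (W t) = 0)
  /\
  (B^T = - B ->
   forall t, I t ->
     derivable (fun s => \sum_(j < N) omega kappa (U s) (W s) j) t 1 /\
     derive1 (fun s => \sum_(j < N) omega kappa (U s) (W s) j) t = 0).
Proof.
have conservation t : I t ->
    derivable (fun s => dot ((1%:M *t Kmx kappa) *m U s) (W s)) t 1 /\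
    derive1 (fun s => dot ((1%:M *t Kmx kappa) *m U s) (W s)) t
    + dot ((B *t Mmx beta) *m U t) (W t)
    + dot ((B^T *t Mmx beta) *m U t) (W t) = 0.
  move=> It; have [dU eqU] := hU t It; have [dW eqW] := hW t It.
  have [] : is_derive t 1 (fun s => dot ((1%:M *t Kmx kappa) *m U s) (W s))
      (dot ((1%:M *t Kmx kappa) *m derive1 U t) (W t)
       + dot ((1%:M *t Kmx kappa) *m U t) (derive1 W t)).
    rewrite !derive1E; apply: is_derive_dot => i.
      exact: is_derive_row (derivableP dU).
    exact: is_derive_coord (derivableP dW).
  move=> dbl; rewrite -derive1E => ->; split=> //.
  apply: multisymplectic_identity eqU eqW.
  - by rewrite trmx_tens trmx1 trmx_Kmx tensmxNr.
  - by rewrite trmx_tens trmx_Mmx tensmxNr.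
  - exact: trmx_hessS.
split=> // skewB t It; have [dbl eq0] := conservation t It.
have -> : (fun s => \sum_(j < N) omega kappa (U s) (W s) j) =
    (fun s => dot ((1%:M *t Kmx kappa) *m U s) (W s)).
  by apply/funext => s; rewrite sum_omega.
split=> //; move: eq0.
by rewrite skewB tensmxNl mulNmx dotNl addrK.
Qed.
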